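(* If $G$ is a $\{P_6,C_5,\overline{P_5},K_{1,3}\}$-free graph that contains an induced $C_6$, then $G$ is $k$-indicated colorable for all $k\geq\chi(G)$.
   Context: All graphs are finite, simple and undirected. $P_n$ and $C_n$ denote the path and cycle on $n$ vertices, $K_{1,3}$ is the claw, $\overline{H}$ is the complement of $H$, and $\chi(G)$ is the chromatic number. A graph is $\mathcal{F}$-free if it has no induced subgraph isomorphic to a member of $\mathcal{F}$. Indicated coloring game on $G$ with a fixed set of $k$ colors: in each round Ann selects an uncolored vertex, and then Ben assigns it one of the $k$ colors not already used on its neighbors (so that the partial coloring stays proper). Ann wins if the whole graph gets properly colored; Ben wins if at some stage there is an uncolored vertex all $k$ colors of which appear on its neighbors. $G$ is $k$-indicated colorable if Ann has a winning strategy (regardless of how Ben plays) with $k$ colors. *)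

(* Defs.v *)
From HB Require Import structures.
From mathcomp Require Import all_boot.
Set Implicit Arguments.
Unset Strict Implicit.
Unset Printing Implicit Defensive.

Record sgraph := SGraph {
  vertex :> finType;
  edge : rel vertex;
  edge_sym : symmetric edge;
  edge_irr : irreflexive edge }.

Definition path_rel (n : nat) : rel 'I_n :=
  [rel i j : 'I_n | (i.+1 == j :> nat) || (j.+1 == i :> nat)].

Lemma path_rel_sym n : symmetric (@path_rel n).
Proof. by move=> i j; rewrite /path_rel /= orbC. Qed.

Lemma path_rel_irr n : irreflexive (@path_rel n).
Proof. by move=> i; rewrite /path_rel /= orbb gtn_eqF. Qed.

Definition path_graph (n : nat) : sgraph :=
  SGraph (@path_rel_sym n) (@path_rel_irr n).

(* For n < 3 this is not a cycle; the test i != j only removes the loop that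
   n = 1 would create. *)
Definition cycle_rel (n : nat) : rel 'I_n :=
  [rel i j : 'I_n | (i != j) &&
     ((i.+1 %% n == j :> nat) || (j.+1 %% n == i :> nat))].

Lemma cycle_rel_sym n : symmetric (@cycle_rel n).
Proof. by move=> i j; rewrite /cycle_rel /= eq_sym orbC. Qed.

Lemma cycle_rel_irr n : irreflexive (@cycle_rel n).
Proof. by move=> i; rewrite /cycle_rel /= eqxx. Qed.

Definition cycle_graph (n : nat) : sgraph :=
  SGraph (@cycle_rel_sym n) (@cycle_rel_irr n).

Definition biclique_rel (m n : nat) : rel ('I_m + 'I_n)%type :=
  fun x y => match x, y with
             | inl _, inr _ | inr _, inl _ => true
             | _, _ => false
             end.

Lemma biclique_rel_sym m n : symmetric (@biclique_rel m n).
Proof. by case=> i [] j. Qed.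

Lemma biclique_rel_irr m n : irreflexive (@biclique_rel m n).
Proof. by case. Qed.

Definition biclique (m n : nat) : sgraph :=
  SGraph (@biclique_rel_sym m n) (@biclique_rel_irr m n).

Definition compl_rel (G : sgraph) : rel G :=
  [rel x y : G | (x != y) && ~~ edge x y].

Lemma compl_rel_sym (G : sgraph) : symmetric (@compl_rel G).
Proof. by move=> x y; rewrite /compl_rel /= eq_sym edge_sym. Qed.

Lemma compl_rel_irr (G : sgraph) : irreflexive (@compl_rel G).
Proof. by move=> x; rewrite /compl_rel /= eqxx. Qed.

Definition compl_graph (G : sgraph) : sgraph :=
  SGraph (@compl_rel_sym G) (@compl_rel_irr G).

(* The image of f is the vertex set of an induced subgraph isomorphic to H. *)
Definition contains_induced (H G : sgraph) : bool :=
  [exists f : {ffun H -> G},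
     injectiveb f && [forall x, forall y, edge (f x) (f y) == edge x y]].

Definition family_free (F : seq sgraph) (G : sgraph) : bool :=
  all (fun H => ~~ contains_induced H G) F.

Definition colorable (G : sgraph) (k : nat) : bool :=
  [exists f : {ffun G -> 'I_k},
     [forall x, forall y, edge x y ==> (f x != f y)]].

Lemma colorable_ex (G : sgraph) : exists k, colorable G k.
Proof.
exists #|G|; apply/existsP; exists [ffun x => enum_rank x].
apply/forallP=> x; apply/forallP=> y; apply/implyP=> exy.
rewrite !ffunE (inj_eq enum_rank_inj).
by apply: contraTneq exy => ->; rewrite edge_irr.
Qed.

Definition chromatic_number (G : sgraph) : nat := ex_minn (colorable_ex G).

Section Game.
Variables (G : sgraph) (k : nat).

(* None marks an uncolored vertex. *)
Definition position := {ffun G -> option 'I_k}.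

Definition start_position : position := [ffun=> None].

Definition all_colored (c : position) : bool := [forall v, c v != None].

Definition legal (c : position) (v : G) (a : 'I_k) : bool :=
  [forall u, edge v u ==> (c u != Some a)].

Definition assign (c : position) (v : G) (a : 'I_k) : position :=
  [ffun u => if u == v then Some a else c u].

Definition ben_has_won (c : position) : bool :=
  [exists v, (c v == None) && [forall a, exists u, edge v u && (c u == Some a)]].

(* A derivation is a winning strategy tree for Ann from c: it fixes the vertex
   she presents and branches over all legal answers of Ben. Being inductive is
   no restriction, as a play has at most #|G| rounds. *)
Inductive ann_wins (c : position) : Prop :=
| ann_wins_end of all_colored c
| ann_wins_round (v : G) of ~~ ben_has_won c & c v = None
    & (forall a : 'I_k, legal c v a -> ann_wins (assign c v a)).

End Game.

Definition indicated_colorable (G : sgraph) (k : nat) : Prop :=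
  ann_wins (start_position G k).

(* Main.v *)
Require Import Defs.
From HB Require Import structures.
From mathcomp Require Import all_boot all_fingroup zify.
Set Implicit Arguments.
Unset Strict Implicit.
Unset Printing Implicit Defensive.

(* Ann colours one connected component after another, so only the structure of a
   connected {P_6, C_5, co-P_5, claw}-free graph matters.
   - If it contains a C_4, every vertex lies on the C_4 or sees three of its
     vertices; hence there are no three independent vertices, and the complement
     is triangle-free without P_5 and C_5, so bipartite. The vertices split into
     two cliques A and B, and two vertices of B with a common non-neighbour in A
     have nested non-neighbourhoods in A.
   - If it contains a C_6 but no C_4, it is a blow-up of C_6 by cliques.
   - Otherwise it is chordal, and Ann follows a perfect elimination order backwards.
   In the first two cases Ann colours everything but one clique U (B, respectively
   two consecutive parts of the blow-up) greedily, in such a way that an extension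
   g to U exists. The colour lists left on U are laminar up to the colours in all
   lists, and then Ann can always present a vertex for which any answer of Ben is
   compensated by swapping two values of g. *)

(** * Forcing strategies *)

Section Forcing.
Variables (G : sgraph) (k : nat).
Implicit Types (c : position G k) (u v w : G) (a b : 'I_k) (S T U : {set G}).

(** Arbitrary goals [Q] let strategies for single phases be composed. Only the presented vertex
    needs a legal colour; that no other vertex gets blocked follows once the goal is a full
    colouring. *)
Inductive forces (Q : position G k -> Prop) c : Prop :=
| forces_now of Q c
| forces_round v of c v = None & (exists a, legal c v a)
    & (forall a, legal c v a -> forces Q (assign c v a)).

Lemma forces_bind (Q R : position G k -> Prop) c :
  forces Q c -> (forall c', Q c' -> forces R c') -> forces R c.
Proof.
move=> fQ QR; elim: fQ => [{}c /QR//|{}c v cv ex_a _ IH].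
exact: forces_round cv ex_a IH.
Qed.

(** A blocked vertex has no legal colour, so it is never presented, and it stays blocked because
    colours are never withdrawn; a full colouring would be out of reach. *)
Lemma forces_not_blocked c :
  forces (fun c' => all_colored c') c -> ~~ ben_has_won c.
Proof.
elim=> [{}c /forallP col|{}c v cv [a la] _ IH].
  by apply/existsP=> -[v /andP[]]; rewrite (negPf (col v)).
apply/existsP=> -[w /andP[/eqP cw /forallP blocked]].
have wv : w != v.
  apply/eqP=> wv; have /existsP[u /andP[vu cu]] := blocked a.
  by move/forallP/(_ u): la; rewrite -wv vu /= cu.
case/existsP: (IH a la); exists w; rewrite ffunE (negPf wv) cw eqxx /=.
apply/forallP=> b; have /existsP[u /andP[wu cu]] := blocked b.
apply/existsP; exists u; rewrite wu ffunE /=.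
by case: (eqVneq u v) cu => [->|//]; rewrite cv.
Qed.

Lemma forces_ann_wins c : forces (fun c' => all_colored c') c -> ann_wins c.
Proof.
elim=> [{}c|{}c v cv ex_a fc IH]; first exact: ann_wins_end.
apply: (ann_wins_round _ cv IH).
exact: forces_not_blocked (forces_round cv ex_a fc).
Qed.

Definition properly_colored c :=
  forall u v a, edge u v -> c u = Some a -> c v != Some a.

(** A phase colours all of [S] and changes nothing outside, so the next phase knows its starting
    position. *)
Definition extends S c c' : Prop :=
  [/\ properly_colored c', {in S, forall u, c' u != None}
    & forall u, u \notin S -> c' u = c u].

Lemma proper_assign c v a :
  properly_colored c -> legal c v a -> properly_colored (assign c v a).
Proof.
move=> pc /forallP la u w b uw; rewrite !ffunE.
case: (eqVneq u v) => [uv [<-]|uv cu]; case: (eqVneq w v) => [wv|wv].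
- by rewrite uv wv edge_irr in uw.
- by move: (la w); rewrite -uv uw.
- apply/eqP=> -[ab]; move: (la u); rewrite -wv edge_sym uw cu ab.
  by rewrite eqxx.
- exact: pc uw cu.
Qed.

Lemma legal_assign c v a u b :
  edge u v -> c v = None ->
  legal (assign c v a) u b = legal c u b && (b != a).
Proof.
move=> uv cv; apply/forallP/andP=> [la|[/forallP la ba] w].
  split; last first.
    by move: (la v); rewrite uv ffunE eqxx /= eq_sym.
  apply/forallP=> w; move: (la w); rewrite ffunE.
  by case: (eqVneq w v) => // ->; rewrite cv implybT.
rewrite ffunE; case: (eqVneq w v) => // _.
by rewrite implybE (inj_eq Some_inj) eq_sym ba orbT.
Qed.

Lemma extends_trans S T c c' c'' :
  extends S c c' -> extends T c' c'' -> extends (S :|: T) c c''.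
Proof.
move=> [_ cS c'E] [pc'' cT c''E]; split=> // u.
  by rewrite inE; case: (boolP (u \in T)) => [/cT//|/c''E->]; rewrite orbF => /cS.
by rewrite inE negb_or => /andP[uS uT]; rewrite c''E ?c'E.
Qed.

Lemma paint_bind S T c :
  forces (extends S c) c ->
  (forall c', extends S c c' -> forces (extends T c') c') ->
  forces (extends (S :|: T) c) c.
Proof.
move=> fS fT; apply: (forces_bind fS) => c' ec.
apply: (forces_bind (fT _ ec)) => c'' ec'.
by apply: forces_now; apply: extends_trans ec ec'.
Qed.

Lemma paint_nil c : properly_colored c -> forces (extends set0 c) c.
Proof. by move=> pc; apply: forces_now; split=> // u; rewrite inE. Qed.

Lemma paint_step S c v :
  v \in S -> c v = None -> (exists a, legal c v a) ->
  (forall a, legal c v a ->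
     forces (extends (S :\ v) (assign c v a)) (assign c v a)) ->
  forces (extends S c) c.
Proof.
move=> vS cv ex_a fS; apply: (forces_round cv ex_a) => a la.
apply: (forces_bind (fS a la)) => c' [pc' cS c'E].
apply: forces_now; split=> // u.
  case: (eqVneq u v) => [->|uv] uS; last by apply: cS; rewrite !inE uv.
  by rewrite c'E ?inE ?eqxx // ffunE eqxx.
move=> uS; have uv : u != v by apply: contraNneq uS => ->.
by rewrite c'E ?ffunE ?(negPf uv) // !inE (negPf uS) andbF.
Qed.

(** If no colour were legal, choosing for each colour a neighbour that carries it would inject the
    [k] colours into [T :\ v], which has fewer than [k] elements. *)
Lemma ex_legal c v T :
  v \in T -> #|T| <= k -> c v = None ->
  (forall w, edge v w -> c w != None -> w \in T) -> exists a, legal c v a.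
Proof.
move=> vT Tk cv vN; apply/existsP; apply: contraT; rewrite negb_exists.
move=> /forallP bad.
have wit a : exists u, edge v u && (c u == Some a).
  move: (bad a); rewrite negb_forall => /existsP[u].
  by rewrite negb_imply negbK => ?; exists u.
pose f a := xchoose (wit a).
have fP a : edge v (f a) && (c (f a) == Some a) := xchooseP (wit a).
have f_inj : injective f.
  move=> a b fab; have /andP[_ /eqP ca] := fP a.
  by have /andP[_ /eqP] := fP b; rewrite -fab ca => -[].
have: #|[set f a | a : 'I_k]| <= #|T :\ v|.
  apply/subset_leq_card/subsetP=> _ /imsetP[a _ ->].
  have /andP[vf /eqP cf] := fP a; rewrite !inE vN ?cf // andbT.
  by apply: contraTneq vf => ->; rewrite edge_irr.
rewrite card_imset // card_ord => kT.
by move: Tk; rewrite (cardsD1 v) vT => /(leq_ltn_trans kT); rewrite ltnn.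
Qed.

(** Any order works: when [u] is presented, its coloured neighbours lie in [T u] besides [u] itself,
    so they block at most [k - 1] colours. *)
Lemma paint_greedy (T : G -> {set G}) S c :
  properly_colored c -> {in S, forall u, c u = None} ->
  {in S, forall u, u \in T u} -> {in S, forall u, #|T u| <= k} ->
  (forall u w, u \in S -> edge u w -> (w \in S) || (c w != None) -> w \in T u) ->
  forces (extends S c) c.
Proof.
have [n] := ubnP #|S|; elim: n => // n IH in S c *.
move=> Sn pc cS ST Tk SN.
have [S0|/set0Pn[v vS]] := eqVneq S set0; first by rewrite S0; apply: paint_nil.
apply: (paint_step vS (cS _ vS)).
  by apply: ex_legal (ST _ vS) (Tk _ vS) (cS _ vS) _ => w vw cw;
    apply: SN; rewrite ?cw ?orbT.
move=> a la; apply: IH => //.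
- by move: Sn; rewrite (cardsD1 v) vS.
- exact: proper_assign.
- by move=> u; rewrite !inE ffunE => /andP[/negPf-> /cS].
- by move=> u; rewrite !inE => /andP[_ /ST].
- by move=> u; rewrite !inE => /andP[_ /Tk].
- move=> u w; rewrite !inE ffunE => /andP[_ uS] uw w_cand; apply: SN => //.
  by case: (eqVneq w v) w_cand => [->|_ //]; rewrite vS.
Qed.

Definition clique S := forall u v, u \in S -> v \in S -> u != v -> edge u v.

(** Lists sharing a colour that is missing from some list of [U] must be nested. This form is
    inherited when a vertex leaves [U] and its colour leaves all lists. *)
Definition laminar_lists c U :=
  forall u v a, u \in U -> v \in U -> legal c u a -> legal c v a ->
  [\/ {in U, forall w, legal c w a},
      forall b, legal c u b -> legal c v b
    | forall b, legal c v b -> legal c u b].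

(* Whatever colour Ben gives the chosen vertex, [g] can be repaired by swapping
   that vertex with the one that [g] gives the colour to. *)
Lemma ex_exchangeable c U (g : G -> 'I_k) :
  U != set0 -> laminar_lists c U -> {in U, forall u, legal c u (g u)} ->
  exists2 v, v \in U & {in U, forall u, legal c v (g u) -> legal c u (g v)}.
Proof.
move=> /set0Pn[v0 v0U] lam lg.
(* A vertex whose colour under [g] lies in all lists is exchangeable at once. *)
have [/existsP[v /andP[vU /forallP uni]]|nuni] :=
  boolP [exists v in U, [forall w in U, legal c w (g v)]].
  by exists v => // u uU _; have := uni u; rewrite uU.
pose L v := [set a | legal c v a].
(* Otherwise a smallest list works: a list nested with it contains it, or is contained in it and
   hence equal to it. *)
case: (@arg_minnP _ v0 (mem U) (fun v => #|L v|) v0U) => v vU vmin.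
exists v => // u uU lvu; case: (lam u v (g u) uU vU (lg u uU) lvu).
- move=> uni; case/existsP: nuni; exists u; rewrite uU /=.
  by apply/forallP=> w; apply/implyP; apply: uni.
- move=> uv; have /eqP LE : L u == L v.
    rewrite eqEcard (vmin _ uU) andbT.
    by apply/subsetP=> b; rewrite !inE; apply: uv.
  by have := lg v vU; have/setP/(_ (g v)) := LE; rewrite !inE => ->.
- by apply; apply: lg.
Qed.

(** The invariant is that [g] picks distinct colours from the lists of the clique [U]. Presenting an
    exchangeable vertex lets it survive every answer of Ben. *)
Lemma paint_laminar c U (g : G -> 'I_k) :
  properly_colored c -> {in U, forall u, c u = None} -> clique U ->
  {in U &, injective g} -> {in U, forall u, legal c u (g u)} ->
  laminar_lists c U -> forces (extends U c) c.
Proof.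
have [n] := ubnP #|U|; elim: n => // n IH in U c g *.
move=> Un pc cU clU g_inj lg lam.
have [U0|Un0] := eqVneq U set0; first by rewrite U0; apply: paint_nil.
have [v vU exch] := ex_exchangeable Un0 lam lg.
apply: (paint_step vU (cU _ vU)); first by exists (g v); apply: lg.
move=> a la.
have legE u b : u \in U :\ v ->
    legal (assign c v a) u b = legal c u b && (b != a).
  rewrite !inE => /andP[uv uU].
  by rewrite legal_assign ?(cU _ vU) // clU.
(* The vertex that was to receive Ben's colour [a], if there is one, takes over [g v]. *)
apply: (IH _ _ (fun u => if g u == a then g v else g u)).
- by move: Un; rewrite (cardsD1 v) vU.
- exact: proper_assign.
- by move=> u; rewrite !inE ffunE => /andP[/negPf-> /cU].
- by move=> u w; rewrite !inE => /andP[_ uU] /andP[_ wU]; apply: clU.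
- move=> u w; rewrite !inE => /andP[uv uU] /andP[wv wU].
  case: (eqVneq (g u) a) => gu; case: (eqVneq (g w) a) => gw.
  + by move=> _; apply: g_inj; rewrite ?gu ?gw.
  + by move/(g_inj _ _ vU wU)=> /eqP; rewrite eq_sym (negPf wv).
  + by move/(g_inj _ _ uU vU)=> /eqP; rewrite (negPf uv).
  + exact: g_inj.
- move=> u uUv; rewrite legE //; move: uUv; rewrite !inE => /andP[uv uU].
  case: (eqVneq (g u) a) => gu; last by rewrite lg.
  rewrite exch ?gu //= -gu; apply: contra_neq uv => gvu.
  by apply: g_inj.
- move=> u w b uUv wUv; rewrite !legE //.
  case/andP=> lu ba /andP[lw _].
  move: (uUv) (wUv); rewrite !inE => /andP[_ uU] /andP[_ wU].
  case: (lam u w b uU wU lu lw) => sub; [apply: Or31|apply: Or32|apply: Or33].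
  + by move=> x xUv; rewrite legE ?ba ?andbT ?sub //; case/setD1P: xUv.
  + by move=> d; rewrite !legE // => /andP[/sub-> ->].
  + by move=> d; rewrite !legE // => /andP[/sub-> ->].
Qed.

End Forcing.

(** * Forbidden induced subgraphs *)

Lemma contains_inducedI (H G : sgraph) (f : H -> G) :
  injective f -> (forall x y, edge (f x) (f y) = edge x y) ->
  contains_induced H G.
Proof.
move=> f_inj fE; apply/existsP; exists (finfun f); apply/andP; split.
  by apply/injectiveP=> x y; rewrite !ffunE => /f_inj.
by apply/forallP=> x; apply/forallP=> y; rewrite !ffunE fE.
Qed.

(** Adjacency separates the vertices of such a graph, so a map that preserves and reflects edges is
    injective, and distinctness of the images need not be checked. *)
Definition twin_free (H : sgraph) :=
  forall x y : H, (forall z, edge x z = edge y z) -> x = y.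

Lemma contains_induced_twin_free (H G : sgraph) (f : H -> G) :
  twin_free H -> (forall x y, edge (f x) (f y) = edge x y) ->
  contains_induced H G.
Proof.
move=> tf fE; apply: contains_inducedI (fE) => x y fxy.
by apply: tf => z; rewrite -!fE fxy.
Qed.

Lemma path6_twin_free : twin_free (path_graph 6).
Proof.
move=> x y tw; apply: val_inj; move: {tw}(fun z lz => tw (@Ordinal 6 z lz)) => tw.
move: (tw 0 isT) (tw 1 isT) (tw 2 isT) (tw 3 isT) (tw 4 isT) (tw 5 isT).
by case: x y {tw} => [[|[|[|[|[|[|//]]]]]] ?] [[|[|[|[|[|[|//]]]]]] ?].
Qed.

Lemma cycle5_twin_free : twin_free (cycle_graph 5).
Proof.
move=> x y tw; apply: val_inj; move: {tw}(fun z lz => tw (@Ordinal 5 z lz)) => tw.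
move: (tw 0 isT) (tw 1 isT) (tw 2 isT) (tw 3 isT) (tw 4 isT).
by case: x y {tw} => [[|[|[|[|[|//]]]]] ?] [[|[|[|[|[|//]]]]] ?].
Qed.

Lemma copath5_twin_free : twin_free (compl_graph (path_graph 5)).
Proof.
move=> x y tw; apply: val_inj; move: {tw}(fun z lz => tw (@Ordinal 5 z lz)) => tw.
move: (tw 0 isT) (tw 1 isT) (tw 2 isT) (tw 3 isT) (tw 4 isT).
by case: x y {tw} => [[|[|[|[|[|//]]]]] ?] [[|[|[|[|[|//]]]]] ?].
Qed.

Ltac edges := first [assumption | by rewrite edge_sym
  | by rewrite edge_irr | by rewrite eq_sym].

Section Patterns.
Variable G : sgraph.
Implicit Types a b c d e f u v w x y z : G.

Lemma path6_free a b c d e f :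
  ~~ contains_induced (path_graph 6) G ->
  edge a b -> edge b c -> edge c d -> edge d e -> edge e f ->
  edge a c = false -> edge a d = false -> edge a e = false ->
  edge a f = false -> edge b d = false -> edge b e = false ->
  edge b f = false -> edge c e = false -> edge c f = false ->
  edge d f = false -> False.
Proof.
move=> /negP free *; apply: free.
apply: (@contains_induced_twin_free (path_graph 6) G
          (fun i : 'I_6 => nth a [:: a; b; c; d; e; f] i) path6_twin_free).
by case=> [[|[|[|[|[|[|//]]]]]] ?] [[|[|[|[|[|[|//]]]]]] ?]; simpl; edges.
Qed.

Lemma cycle5_free a b c d e :
  ~~ contains_induced (cycle_graph 5) G ->
  edge a b -> edge b c -> edge c d -> edge d e -> edge e a ->
  edge a c = false -> edge a d = false -> edge b d = false ->
  edge b e = false -> edge c e = false -> False.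
Proof.
move=> /negP free *; apply: free.
apply: (@contains_induced_twin_free (cycle_graph 5) G
          (fun i : 'I_5 => nth a [:: a; b; c; d; e] i) cycle5_twin_free).
by case=> [[|[|[|[|[|//]]]]] ?] [[|[|[|[|[|//]]]]] ?]; simpl; edges.
Qed.

Lemma copath5_free a b c d e :
  ~~ contains_induced (compl_graph (path_graph 5)) G ->
  edge a b = false -> edge b c = false -> edge c d = false ->
  edge d e = false -> edge a c -> edge a d -> edge a e ->
  edge b d -> edge b e -> edge c e -> False.
Proof.
move=> /negP free *; apply: free.
apply: (@contains_induced_twin_free (compl_graph (path_graph 5)) G
          (fun i : 'I_5 => nth a [:: a; b; c; d; e] i) copath5_twin_free).
by case=> [[|[|[|[|[|//]]]]] ?] [[|[|[|[|[|//]]]]] ?]; simpl; edges.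
Qed.

(** The leaves of a claw are twins, so their distinctness has to be assumed. *)
Lemma claw_free x a b c :
  ~~ contains_induced (biclique 1 3) G ->
  edge x a -> edge x b -> edge x c -> a != b -> a != c -> b != c ->
  edge a b = false -> edge a c = false -> edge b c = false -> False.
Proof.
move=> /negP free xa xb xc ab ac bc *; apply: free.
have x_ne z : edge x z -> x != z.
  by apply: contraTneq => <-; rewrite edge_irr.
apply: (@contains_inducedI (biclique 1 3) G (fun i : 'I_1 + 'I_3 =>
  if i is inr j then nth x [:: a; b; c] j else x)).
  move=> [i|i] [j|j]; first by rewrite !ord1.
  - by case: j => [[|[|[|//]]] ?] /= /eqP; rewrite (negPf (x_ne _ _)).
  - by case: i => [[|[|[|//]]] ?] /= /eqP; rewrite eq_sym (negPf (x_ne _ _)).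
  - by case: i j => [[|[|[|//]]] ?] [[|[|[|//]]] ?] /= /eqP;
      rewrite 1?(negPf ab) 1?(negPf ac) 1?(negPf bc) 1?eq_sym
              ?(negPf ab) ?(negPf ac) ?(negPf bc) // => _; congr inr; apply: val_inj.
case=> [i|[[|[|[|//]]] ?]] [j|[[|[|[|//]]] ?]]; simpl; edges.
Qed.

End Patterns.

(** * Simplicial vertices *)

Section Simplicial.
Variable G : sgraph.
Implicit Types (a b c d e f s t u v w x y : G) (W C : {set G}).

(** Opposite vertices of a C_4 are twins, whence the two inequalities; in [is_c6] the adjacencies
    already force distinctness. *)
Definition is_c4 a b c d :=
  [&& edge a b, edge b c, edge c d, edge d a,
      a != c, b != d, ~~ edge a c & ~~ edge b d].

Definition is_c6 a b c d e f :=
  [&& edge a b, edge b c, edge c d, edge d e, edge e f, edge f a,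
      ~~ edge a c, ~~ edge b d, ~~ edge c e, ~~ edge d f, ~~ edge e a,
      ~~ edge f b, ~~ edge a d, ~~ edge b e & ~~ edge c f].

Definition c4_free_in W :=
  forall a b c d, a \in W -> b \in W -> c \in W -> d \in W ->
  is_c4 a b c d = false.

Definition c6_free_in W :=
  forall a b c d e f,
  a \in W -> b \in W -> c \in W -> d \in W -> e \in W -> f \in W ->
  is_c6 a b c d e f = false.

Hypothesis P6_free : ~~ contains_induced (path_graph 6) G.
Hypothesis C5_free : ~~ contains_induced (cycle_graph 5) G.

Definition inside C : rel G := [rel u v | (v \in C) && edge u v].

(* A shortest path through [C] from [s] to [t] closes up with [b] to an induced
   cycle, or already contains an induced [P_6] together with [b]. *)
Lemma no_bypass W C b s t (p : seq G) :
  c4_free_in W -> c6_free_in W -> C \subset W ->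
  b \in W -> s \in W -> t \in W -> b \notin C -> s != t ->
  {in C, forall u, edge b u = false} -> edge b s -> edge b t ->
  edge s t = false -> path (@edge G) s (rcons p t) -> all (mem C) p -> False.
Proof.
move=> W4 W6 /subsetP CW bW sW tW bC st bN bs bt nst.
have bne u : u \in C -> b != u by apply: contraTneq => <-.
have sym := @edge_sym G.
have [n] := ubnP (size p); elim: n => // n IH in p *.
(* One, two or three inner vertices give a C_4, C_5 or C_6 through [b], and four or more give a P_6
   starting at [b]; any chord shortens the path and the induction hypothesis applies. *)
case: p => [|c1 [|c2 [|c3 [|c4 p]]]] /=; rewrite ?ltnS => sn.
- by rewrite nst.
- move=> /and3P[sc1 c1t _] /andP[c1C _].
  have := W4 b s c1 t bW sW (CW _ c1C) tW.
  by rewrite /is_c4 bs sc1 c1t (sym t) bt bne // st bN // nst.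
- move=> /and4P[sc1 c12 c2t _] /and3P[c1C c2C _].
  case E1: (edge s c2); first by apply: (IH [:: c2]); rewrite //= ?E1 ?c2t ?c2C.
  case E2: (edge c1 t); first by apply: (IH [:: c1]); rewrite //= ?E2 ?sc1 ?c1C.
  by apply: (@cycle5_free G b s c1 c2 t); rewrite // ?bN // sym.
- move=> /and5P[sc1 c12 c23 c3t _] /and4P[c1C c2C c3C _].
  have sn1 := ltnW sn; have sn2 := ltnW sn1.
  case E1: (edge s c2).
    by apply: (IH [:: c2; c3]); rewrite //= ?E1 ?c23 ?c3t ?c2C ?c3C.
  case E2: (edge s c3); first by apply: (IH [:: c3]); rewrite //= ?E2 ?c3t ?c3C //.
  case E3: (edge c1 c3).
    by apply: (IH [:: c1; c3]); rewrite //= ?sc1 ?E3 ?c3t ?c1C ?c3C.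
  case E4: (edge c1 t); first by apply: (IH [:: c1]); rewrite //= ?sc1 ?E4 ?c1C //.
  case E5: (edge c2 t).
    by apply: (IH [:: c1; c2]); rewrite //= ?sc1 ?c12 ?E5 ?c1C ?c2C.
  have := W6 b s c1 c2 c3 t bW sW (CW _ c1C) (CW _ c2C) (CW _ c3C) tW.
  by rewrite /is_c6 bs sc1 c12 c23 c3t (sym t b) (sym c3 b) (sym t s) bt !bN //
             E1 E3 E5 nst E2 E4.
- move=> /and5P[sc1 c12 c23 c34 pth] /and5P[c1C c2C c3C c4C pC].
  have sn1 := ltnW sn; have sn2 := ltnW sn1.
  case E1: (edge s c2).
    by apply: (IH [:: c2, c3, c4 & p]); rewrite //= ?E1 ?c23 ?c34 ?c2C ?c3C ?c4C.
  case E2: (edge s c3).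
    by apply: (IH [:: c3, c4 & p]); rewrite //= ?E2 ?c34 ?c3C ?c4C //.
  case E3: (edge s c4).
    by apply: (IH (c4 :: p)); rewrite //= ?E3 ?c4C //.
  case E4: (edge c1 c3).
    by apply: (IH [:: c1, c3, c4 & p]); rewrite //= ?sc1 ?E4 ?c34 ?c1C ?c3C ?c4C.
  case E5: (edge c1 c4).
    by apply: (IH [:: c1, c4 & p]); rewrite //= ?sc1 ?E5 ?c1C ?c4C //.
  case E6: (edge c2 c4).
    by apply: (IH [:: c1, c2, c4 & p]); rewrite //= ?sc1 ?c12 ?E6 ?c1C ?c2C ?c4C.
  by apply: (@path6_free G b s c1 c2 c3 c4); rewrite // bN.
Qed.

Lemma inside_path C x (p : seq G) :
  path (inside C) x p -> path (@edge G) x p && all (mem C) p.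
Proof.
elim: p x => //= y p IH x /andP[/andP[-> ->] /IH/andP[-> ->]]; exact.
Qed.

(* The complement of [C] and its neighbourhood is completely joined to the
   neighbourhood of a maximal connected set [C] missing some vertex. *)
Lemma ex_simplicial W :
  c4_free_in W -> c6_free_in W -> W != set0 ->
  exists2 v, v \in W & clique [set u in W | edge v u].
Proof.
have [n] := ubnP #|W|; elim: n => // n IH in W *.
move=> Wn W4 W6 Wn0.
have [/existsP[x /andP[xW /existsP[y /and3P[yW xy nxy]]]]|complete] :=
    boolP [exists x in W, [exists y, [&& y \in W, x != y & ~~ edge x y]]];
  last first.
  have /set0Pn[v vW] := Wn0; exists v => // u w; rewrite !inE.
  move=> /andP[uW _] /andP[wW _] uw; apply: contraNT complete => nuw.
  by apply/existsP; exists u; rewrite uW; apply/existsP; exists w; rewrite wW uw.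
(* The predicate [P C] says that [C] is connected and that some vertex of [W] is neither in [C] nor
   adjacent to it. A maximal such set is taken. *)
pose missed C := [set z in W | (z \notin C) && [forall u in C, ~~ edge u z]].
pose P C := [&& C \subset W, missed C != set0 &
              [forall u in C, forall w in C, connect (inside C) u w]].
have P1 : P [set x].
  apply/and3P; split; first by rewrite sub1set.
    apply/set0Pn; exists y; rewrite !inE yW eq_sym xy /=.
    by apply/forallP=> u; apply/implyP; rewrite inE => /eqP->.
  apply/forallP=> u; apply/implyP; rewrite inE => /eqP->.
  by apply/forallP=> w; apply/implyP; rewrite inE => /eqP->; apply: connect0.
have [C /maxsetP[/and3P[CW B0 /forallP conn] Cmax]] := maxset_exists P1.
rewrite sub1set => xC.
have missedE z : z \in missed C -> [/\ z \in W, z \notin C &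
    {in C, forall u, edge u z = false}].
  rewrite inE => /and3P[zW zC /forallP nz]; split=> // u uC.
  by apply/negbTE; have := nz u; rewrite uC.
have nbr s : s \in W -> s \notin missed C -> s \notin C ->
    exists2 u, u \in C & edge u s.
  move=> sW; rewrite inE sW => sB sC; move: sB; rewrite sC /= negb_forall.
  by case/existsP=> u; rewrite negb_imply negbK => /andP[]; exists u.
(* Otherwise [s |: C] would still be connected and still miss [b], against maximality. *)
have joined s b : s \in W -> s \notin missed C -> s \notin C ->
    b \in missed C -> edge b s.
  move=> sW sB sC bB; have [u uC us] := nbr s sW sB sC.
  have [bW bC nb] := missedE _ bB.
  apply: contraNT sC => nbs; rewrite -(Cmax (s |: C)) ?setU11 ?subsetUr //.
  apply/and3P; split; first by rewrite subUset sub1set sW.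
    apply/set0Pn; exists b; rewrite !inE bW negb_or bC !andbT /=.
    apply/andP; split; first by apply: contraNneq sB => <-.
    apply/forallP=> w; apply/implyP; rewrite !inE => /orP[/eqP->|/nb->//].
    by rewrite edge_sym.
  have sub v w : v \in C -> w \in C -> connect (inside (s |: C)) v w.
    move=> vC wC; have := conn v; rewrite vC /= => /forallP/(_ w).
    rewrite wC /=; apply: connect_sub => p q /andP[qC pq].
    by apply: connect1; rewrite /inside /= !inE qC orbT.
  have hub v : v \in s |: C -> connect (inside (s |: C)) v u
                            && connect (inside (s |: C)) u v.
    case/setU1P=> [->|vC]; last by rewrite !sub.
    by rewrite !connect1 /inside /= ?setU11 // !inE uC orbT edge_sym us.
  apply/forallP=> v; apply/implyP=> /hub/andP[vu _].
  apply/forallP=> w; apply/implyP=> /hub/andP[_ uw].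
  exact: connect_trans vu uw.
have BW : missed C \subset W by apply/subsetP=> z /missedE[].
(* A simplicial vertex [v] of [missed C] is simplicial in [W]: its further neighbours are neighbours
   of [C], joined to all of [missed C], and two non-adjacent ones would be linked by a path through
   [C]. *)
have [|||v vB Bcl] := IH (missed C) _ _ _ B0.
- rewrite ltnS in Wn; apply: leq_trans Wn; apply: proper_card.
  apply/properP; split=> //; exists x => //.
  by rewrite inE xC andbF.
- by move=> a b c d aB bB cB dB; apply: W4; apply: (subsetP BW).
- by move=> a b c d e f aB bB cB dB eB fB; apply: W6; apply: (subsetP BW).
have [vW vC nv] := missedE v vB.
exists v => // s t; rewrite !inE => /andP[sW vs] /andP[tW vt] st.
have notC u : edge v u -> u \notin C.
  by move=> vu; apply/negP=> /nv; rewrite edge_sym vu.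
have [sB|sB] := boolP (s \in missed C); have [tB|tB] := boolP (t \in missed C).
- by apply: Bcl => //; rewrite inE ?sB ?tB.
- by rewrite joined // notC.
- by rewrite edge_sym joined // notC.
have [u uC us] := nbr s sW sB (notC _ vs).
have [w wC wt] := nbr t tW tB (notC _ vt).
have := conn u; rewrite uC => /forallP/(_ w); rewrite wC /=.
case/connectP=> p /inside_path/andP[pe pC] wE.
case nst: (edge s t) => //; exfalso.
apply: (@no_bypass W C v s t (u :: p)); rewrite //= ?uC //.
- by move=> z zC; rewrite edge_sym nv.
- by rewrite rcons_path edge_sym us pe -wE.
Qed.
End Simplicial.

(** * Chordal and co-bipartite graphs *)

Definition proper_coloring (G : sgraph) (T : eqType) (f : G -> T) :=
  forall u v, edge u v -> f u != f v.

Lemma ex_proper_coloring (G : sgraph) k :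
  chromatic_number G <= k -> exists f : G -> 'I_k, proper_coloring f.
Proof.
rewrite /chromatic_number; case: ex_minnP => n /existsP[f /forallP fP] _ nk.
exists (fun x => widen_ord nk (f x)) => u v uv.
have /forallP/(_ v) := fP u; rewrite uv /=; apply: contra => /eqP fuv.
by apply/eqP/val_inj; move/(congr1 val): fuv.
Qed.

Lemma clique_coloring_inj (G : sgraph) (T : eqType) (f : G -> T) (S : {set G}) :
  proper_coloring f -> clique S -> {in S &, injective f}.
Proof.
move=> fP Scl u v uS vS fuv; apply: contra_eq (fuv) => uv.
exact/fP/Scl.
Qed.

Lemma clique_card (G : sgraph) k (f : G -> 'I_k) (S : {set G}) :
  proper_coloring f -> clique S -> #|S| <= k.
Proof.
move=> fP /(clique_coloring_inj fP) f_inj.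
by rewrite -(card_in_imset f_inj) -[X in _ <= X]card_ord max_card.
Qed.

(** Two injective colourings of [A] differ by a renaming of colours. This turns a fixed colouring of
    the whole graph into one that agrees with Ben's choices on a clique. *)
Lemma perm_agree (aT T : finType) (f : aT -> T) (c : aT -> option T)
    (A : {set aT}) :
  {in A &, injective f} -> {in A &, injective c} ->
  {in A, forall u, c u != None} ->
  exists s : {perm T}, {in A, forall u, c u = Some (s (f u))}.
Proof.
have [n] := ubnP #|A|; elim: n => // n IH in A *.
have [-> _ _ _ _|/set0Pn[v vA] An f_inj c_inj cA] := eqVneq A set0.
  by exists 1%g => u; rewrite inE.
have sub u : u \in A :\ v -> u \in A by case/setD1P.
have [|u w /sub uA /sub|u w /sub uA /sub|u /sub|s sE] := IH (A :\ v).
- by move: An; rewrite (cardsD1 v) vA.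
- exact: f_inj.
- exact: c_inj.
- exact: cA.
case cv : (c v) => [a|]; last by have := cA v vA; rewrite cv.
(* The transposition corrects the value at [v] and moves no other value on [A], because [f] and [c]
   are injective there. *)
exists (s * tperm (s (f v)) a)%g => u uA; rewrite permM.
have [->|uv] := eqVneq u v; first by rewrite tpermL.
have cu := sE u; rewrite !inE uv uA in cu; rewrite cu // tpermD //.
  by apply: contra_neq uv => /perm_inj/esym; apply: f_inj.
apply: contra_neq uv => sfu; apply: c_inj => //.
by rewrite cv cu // sfu.
Qed.

(** * Painting chordal sets and pairs of cliques *)

Section Paint.
Variables (G : sgraph) (k : nat) (f : G -> 'I_k).
Hypothesis fP : proper_coloring f.
Implicit Types (c : position G k) (u v w : G) (W K A B : {set G}).

(** A simplicial vertex [v] is left to the end: the rest is painted by induction, and then [v] and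
    its coloured neighbours lie in a clique, which has at most [k] vertices. *)
Lemma paint_chordal c W :
  ~~ contains_induced (path_graph 6) G ->
  ~~ contains_induced (cycle_graph 5) G ->
  c4_free_in W -> c6_free_in W -> properly_colored c ->
  {in W, forall u, c u = None} ->
  (forall u w, u \in W -> edge u w -> c w = None) ->
  forces (extends W c) c.
Proof.
move=> P6f C5f W4 W6 pc cW cN.
have [n] := ubnP #|W|; elim: n => // n IH in W W4 W6 cW cN *.
have [-> _|W0 Wn] := eqVneq W set0; first exact: paint_nil.
have [v vW vcl] := ex_simplicial P6f C5f W4 W6 W0.
have sub u : u \in W :\ v -> u \in W by case/setD1P.
rewrite -(setD1K vW) setUC; apply: paint_bind.
  apply: IH.
  - by move=> ? ? ? ? /sub ? /sub ? /sub ? /sub ?; apply: W4.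
  - by move=> ? ? ? ? ? ? /sub ? /sub ? /sub ? /sub ? /sub ? /sub ?; apply: W6.
  - by move=> u /sub/cW.
  - by move=> u w /sub; apply: cN.
  - by move: Wn; rewrite (cardsD1 v) vW.
move=> c' [pc' _ c'E].
apply: (@paint_greedy _ _ (fun=> v |: [set u in W | edge v u])) => //.
- by move=> u; rewrite inE => /eqP->; rewrite c'E ?cW // !inE eqxx.
- by move=> u; rewrite inE => /eqP->; rewrite setU11.
- move=> _ _; apply: (clique_card fP) => u w; rewrite !inE.
  case: (eqVneq u v) (eqVneq w v) => [->|_] [->|_] //=; rewrite ?eqxx //.
  + by move=> _ /andP[].
  + by move=> /andP[_]; rewrite edge_sym.
  + by move=> uW wW; apply: vcl; rewrite inE.
- move=> u w; rewrite inE => /eqP-> vw; rewrite !inE vw andbT => w_cand.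
  case: (boolP (w \in W :\ v)) => [/sub->|wW]; first by rewrite orbT.
  by move: w_cand; rewrite c'E // (cN v) // orbF => ->.
Qed.

(** Once [A] is painted in any order, [f] with its colours renamed to match [A] gives an injective
    choice on [B]; what remains is that the lists on [B] are laminar. *)
Lemma paint_two_cliques c A B :
  ~~ contains_induced (compl_graph (path_graph 5)) G ->
  clique A -> clique B -> [disjoint A & B] ->
  properly_colored c -> {in A :|: B, forall u, c u = None} ->
  (forall u w, u \in A :|: B -> edge u w -> w \in A :|: B) ->
  forces (extends (A :|: B) c) c.
Proof.
move=> P5f Acl Bcl AB pc cK cN.
have inA u : u \in A -> u \in A :|: B by rewrite inE => ->.
have inB u : u \in B -> u \in A :|: B by rewrite inE => ->; rewrite orbT.
have BA u : u \in B -> u \notin A by apply: contraTN => /(disjointFr AB)->.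
apply: paint_bind.
  apply: (@paint_greedy _ _ (fun=> A)) => //; first by move=> u /inA/cK.
    by move=> _ _; apply: clique_card fP Acl.
  by move=> u w /inA uK uw; rewrite cK ?orbF //; apply: cN uw.
move=> c' [pc' c'A c'E].
have c'N u w a : u \in B -> edge u w -> c' w = Some a -> w \in A.
  move=> /inB uK uw c'w; apply: contra_eqT c'w => wA.
  by rewrite c'E // cK //; apply: cN uw.
have legP u a : u \in B ->
    reflect {in A, forall w, edge u w -> c' w != Some a} (legal c' u a).
  move=> uB; apply: (iffP forallP) => [leg w _ uw|leg w].
    by have := leg w; rewrite uw.
  apply/implyP=> uw; apply/eqP=> c'w.
  by have /eqP := leg w (c'N _ _ _ uB uw c'w) uw.
have c'_inj : {in A &, injective c'}.
  move=> u w uA wA cuw; apply: contra_eq (cuw) => uw.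
  case cu: (c' u) => [a|]; last by have := c'A u uA; rewrite cu.
  by rewrite eq_sym; apply: pc' cu; apply: Acl.
have [s sE] := perm_agree (clique_coloring_inj fP Acl) c'_inj c'A.
apply: (@paint_laminar _ _ _ _ (fun u => s (f u))) => //.
- by move=> u uB; rewrite c'E ?BA // cK // inB.
- by move=> u w uB wB /perm_inj; apply: (clique_coloring_inj fP Bcl).
- move=> u uB; apply/legP=> // w wA uw; rewrite sE //.
  by rewrite (inj_eq Some_inj) (inj_eq perm_inj) eq_sym fP.
- move=> u v a uB vB lu lv.
  have [/existsP[y /andP[yA /eqP cy]]|/existsPn nA] :=
    boolP [exists y in A, c' y == Some a]; last first.
    apply: Or31 => w wB; apply/legP=> // y yA _.
    by have := nA y; rewrite yA.
  have nadj w : w \in B -> legal c' w a -> edge y w = false.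
    move=> wB /(legP _ _ wB)/(_ y yA) lw; rewrite edge_sym.
    by apply/negP=> /lw; rewrite cy eqxx.
  have yu := nadj u uB lu; have yv := nadj v vB lv.
  (* If neither neighbourhood in [A] contains the other, as witnessed by [x] and [z], then [x], [v],
     [y], [u], [z] is an induced P_5 of the complement. *)
  have [/existsP[x /and3P[xA xu xv]]|/existsPn none] :=
      boolP [exists x in A, edge u x && ~~ edge v x]; last first.
    apply: Or33 => b /(legP _ _ vB) lb; apply/legP=> // x xA ux; apply: lb => //.
    by have := none x; rewrite xA ux /= negbK.
  have [/existsP[z /and3P[zA zv zu]]|/existsPn none] :=
      boolP [exists z in A, edge v z && ~~ edge u z]; last first.
    apply: Or32 => b /(legP _ _ uB) lb; apply/legP=> // z zA vz; apply: lb => //.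
    by have := none z; rewrite zA vz /= negbK.
  have ne x1 x2 w : edge w x1 -> edge w x2 = false -> x1 != x2.
    by move=> w1 w2; apply: contraFneq w2 => <-.
  have := @copath5_free G x v y u z P5f; case.
  + by rewrite edge_sym (negPf xv).
  + by rewrite edge_sym.
  + by [].
  + by rewrite (negPf zu).
  + by apply: Acl => //; apply: (ne _ _ u) => //; rewrite edge_sym.
  + by rewrite edge_sym.
  + by apply: Acl => //; apply: (ne _ _ u) => //; apply: negbTE.
  + by apply: Bcl => //; apply: contraNneq xv => ->.
  + by [].
  + apply: Acl => //; rewrite eq_sym; apply: (ne _ _ v) => //.
    by rewrite edge_sym.
Qed.
End Paint.

(** * Graphs with an induced C_4 *)

Section CoBipartite.
Variable G : sgraph.
Hypothesis C5_free : ~~ contains_induced (cycle_graph 5) G.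
Hypothesis coP5_free : ~~ contains_induced (compl_graph (path_graph 5)) G.
Variable K : {set G}.
Hypothesis alpha2 : forall x y z, x \in K -> y \in K -> z \in K ->
  x != y -> x != z -> y != z -> [|| edge x y, edge x z | edge y z].
Implicit Types u v w x y z p q : G.

Definition coedge x y := [&& x \in K, y \in K, x != y & ~~ edge x y].

Lemma coedge_sym : symmetric coedge.
Proof.
move=> x y; rewrite /coedge edge_sym eq_sym.
by case: (x \in K); case: (y \in K).
Qed.

Lemma coedge_triangle x y z : coedge x y -> coedge y z -> coedge x z = false.
Proof.
move=> /and4P[xK yK xy nxy] /and4P[_ zK yz nyz].
apply/negP=> /and4P[_ _ xz nxz].
by have := alpha2 xK yK zK xy xz yz; rewrite (negPf nxy) (negPf nyz) (negPf nxz).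
Qed.

Lemma coedge_edge x y :
  x \in K -> y \in K -> x != y -> coedge x y = false -> edge x y.
Proof. by move=> xK yK xy; rewrite /coedge xK yK xy /= => /negbFE. Qed.

(** Distance 0 or 2 in the complement. On [K] the complement is triangle-free without induced P_5
    and C_5, which makes this an equivalence; its classes are the sides of the components. *)
Definition same_side u v :=
  (u == v) || [exists p, coedge u p && coedge p v].

Lemma same_sideI u p v : coedge u p -> coedge p v -> same_side u v.
Proof. by move=> up pv; apply/orP; right; apply/existsP; exists p; rewrite up. Qed.

Lemma same_side_sym : symmetric same_side.
Proof.
have half u v : same_side u v -> same_side v u.
  case/orP=> [/eqP->|/existsP[p /andP[up pv]]]; first by rewrite /same_side eqxx.
  by apply: (@same_sideI _ p); rewrite coedge_sym.
by move=> u v; apply/idP/idP; apply: half.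
Qed.

(* Otherwise [u], [p], [v], [q], [w] would induce the complement of [C_5] or
   of [P_5]. *)
Lemma same_side_trans : transitive same_side.
Proof.
move=> v u w /orP[/eqP-> //|/existsP[p /andP[up pv]]].
move=> /orP[/eqP <-|/existsP[q /andP[vq qw]]]; first exact: same_sideI up pv.
have [->|uw] := eqVneq u w; first by rewrite /same_side eqxx.
have [uv|uv] := eqVneq u v; first by rewrite uv; apply: same_sideI vq qw.
have [vw|vw] := eqVneq v w; first by rewrite -vw; apply: same_sideI up pv.
have [pq|pq] := eqVneq p q; first by rewrite -pq in qw; apply: same_sideI up qw.
have [uq|/negbTE uq] := boolP (coedge u q); first exact: same_sideI uq qw.
have [pw|/negbTE pw] := boolP (coedge p w); first exact: same_sideI up pw.
have uq' : u != q.
  apply/eqP=> uqE; have := coedge_triangle up pv.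
  by rewrite uqE coedge_sym vq.
have pw' : p != w.
  apply/eqP=> pwE; have := coedge_triangle pv vq.
  by rewrite pwE coedge_sym qw.
have uvF := coedge_triangle up pv; have vwF := coedge_triangle vq qw.
have pqF := coedge_triangle pv vq.
have [uK pK _ /negbTE nup] := and4P up; have [_ vK _ /negbTE npv] := and4P pv.
have [_ qK _ /negbTE nvq] := and4P vq; have [_ wK _ /negbTE nqw] := and4P qw.
have euv := coedge_edge uK vK uv uvF; have evw := coedge_edge vK wK vw vwF.
have epq := coedge_edge pK qK pq pqF; have euq := coedge_edge uK qK uq' uq.
have epw := coedge_edge pK wK pw' pw.
case nuw: (edge u w); exfalso.
  by apply: (@copath5_free G u p v q w).
(* Here [u], [p], [v], [q], [w] is a 5-cycle of the complement, and C_5 is self-complementary. *)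
apply: (@cycle5_free G u v w p q) => //; by rewrite edge_sym.
Qed.

Lemma coedge_not_same_side u v : coedge u v -> same_side u v = false.
Proof.
move=> uv; apply/negP=> /orP[/eqP uvE|/existsP[p /andP[up pv]]].
  by rewrite uvE /coedge eqxx !andbF in uv.
by rewrite (coedge_triangle up pv) in uv.
Qed.

(** A class is named by the rank of its vertex set, which makes classes comparable. *)
Definition side v := enum_rank [set u | same_side v u].

Lemma sideE u v : same_side u v -> side u = side v.
Proof.
move=> uv; congr enum_rank; apply/setP=> w; rewrite !inE.
apply/idP/idP; apply: same_side_trans => //.
by rewrite same_side_sym.
Qed.

Lemma side_coedge u v : coedge u v -> side u != side v.
Proof.
move=> /coedge_not_same_side uv; apply: contraFneq uv.
move/enum_rank_inj/setP/(_ v); rewrite !inE => ->.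
by rewrite /same_side eqxx.
Qed.

(* Each class of [same_side] has at most one opposite class; [A] takes from
   each such pair the class of smaller rank. *)
Lemma two_cliques : exists A B : {set G},
  [/\ A :|: B = K, [disjoint A & B], clique A & clique B].
Proof.
pose A := [set v in K | [exists x, coedge v x && (side v < side x)]].
(* All co-neighbours of [u] lie in the class of [v], so a single one decides where [u] goes. *)
have inA u v : coedge u v -> (u \in A) = (side u < side v).
  move=> uv; have [uK _ _ _] := and4P uv; rewrite inE uK /=.
  apply/existsP/idP => [[x /andP[ux]]|lt_uv]; last by exists v; rewrite uv.
  rewrite (@sideE x v) //; apply: (@same_sideI _ u) => //.
  by rewrite coedge_sym.
have AK u : u \in A -> u \in K by rewrite inE => /andP[].
exists A, (K :\: A); split.
- apply/setP=> u; rewrite in_setU in_setD.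
  by case: (boolP (u \in A)) => // /AK.
- rewrite -setI_eq0; apply/eqP/setP=> u; rewrite in_setI in_setD in_set0.
  by case: (u \in A).
- move=> u v uA vA uv; apply: coedge_edge; rewrite ?AK //; apply/negP=> cuv.
  have cvu := cuv; rewrite coedge_sym in cvu.
  move: uA vA; rewrite (inA _ _ cuv) (inA _ _ cvu) => lt1 lt2.
  by have := ltn_trans lt1 lt2; rewrite ltnn.
- move=> u v /setDP[uK uA] /setDP[vK vA] uv; apply: coedge_edge => //.
  apply/negP=> cuv; have cvu := cuv; rewrite coedge_sym in cvu.
  move: uA vA; rewrite (inA _ _ cuv) (inA _ _ cvu) -!leqNgt => le1 le2.
  by have /eqP := side_coedge cuv; apply; apply/val_inj/anti_leq/andP.
Qed.
End CoBipartite.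

(** * The component of an induced C_4 *)

Section SquareNeighbourhood.
Variable G : sgraph.
Hypothesis coP5_free : ~~ contains_induced (compl_graph (path_graph 5)) G.
Hypothesis claw_free_G : ~~ contains_induced (biclique 1 3) G.
Implicit Types a b c d v w x y z : G.

Lemma is_c4P a b c d :
  reflect [/\ [/\ edge a b, edge b c, edge c d & edge d a],
              a != c, b != d, edge a c = false & edge b d = false]
          (is_c4 a b c d).
Proof.
rewrite /is_c4; apply: (iffP idP).
  by do 6!case/andP=> ?; case/andP=> /negbTE ? /negbTE.
by case=> -[-> -> -> ->] -> -> -> ->.
Qed.

Lemma is_c4_rot a b c d : is_c4 a b c d -> is_c4 b c d a.
Proof.
case/is_c4P=> -[? ? ? ?] ? ? ? ?; apply/is_c4P; split=> //.
  by rewrite eq_sym.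
by rewrite edge_sym.
Qed.

Definition meets3 a b c d v :=
  [|| [&& edge v a, edge v b & edge v c], [&& edge v b, edge v c & edge v d],
      [&& edge v c, edge v d & edge v a] | [&& edge v d, edge v a & edge v b]].

Definition square_nbhd a b c d :=
  [set v | (v \in [:: a; b; c; d]) || meets3 a b c d v].

Lemma square_nbhd_rot a b c d : square_nbhd a b c d = square_nbhd b c d a.
Proof.
apply/setP=> v; rewrite !inE /meets3.
case: (v == a); case: (v == b); case: (v == c); case: (v == d) => //=.
by case: (edge v a); case: (edge v b); case: (edge v c); case: (edge v d).
Qed.

(** Off the C_4, a neighbour of [a] missing both [b] and [d] gives a claw at [a]; one seeing exactly
    one of them but not [c] gives the complement of P_5. *)
Lemma square_nbr a b c d v :
  is_c4 a b c d -> edge a v -> v \in square_nbhd a b c d.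
Proof.
move=> /is_c4P[[ab bc cd da] ac bd nac nbd]; rewrite edge_sym => va.
rewrite !inE /meets3 va /=; have [//|vb] := eqVneq v b; first by rewrite orbT.
have [//|vd] := eqVneq v d; first by rewrite !orbT.
case vb' : (edge v b); case vd' : (edge v d); case vc' : (edge v c);
  rewrite ?orbT //; exfalso.
- by apply: (@copath5_free G a c v d b); rewrite // edge_sym.
- apply: (@copath5_free G a c v b d) => //; by rewrite edge_sym.
- apply: (@claw_free G a b d v) => //; by rewrite ?(eq_sym _ v) // edge_sym.
- apply: (@claw_free G a b d v) => //; by rewrite ?(eq_sym _ v) // edge_sym.
Qed.

(** If [w] is off the C_4 and sees no corner, then [v] is no corner and sees two opposite ones,
    which form a claw at [v] together with [w]. *)
Lemma square_nbhd_closed a b c d v w :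
  is_c4 a b c d -> v \in square_nbhd a b c d -> edge v w ->
  w \in square_nbhd a b c d.
Proof.
move=> C vS vw.
have Cb := is_c4_rot C; have Cc := is_c4_rot Cb; have Cd := is_c4_rot Cc.
have Sb := square_nbhd_rot a b c d; have Sc := square_nbhd_rot b c d a.
have Sd := square_nbhd_rot c d a b.
have [aw|/negbTE aw] := boolP (edge a w); first exact: square_nbr.
have [bw|/negbTE bw] := boolP (edge b w); first by rewrite Sb square_nbr.
have [cw|/negbTE cw] := boolP (edge c w); first by rewrite Sb Sc square_nbr.
have [dw|/negbTE dw] := boolP (edge d w).
  by rewrite Sb Sc Sd square_nbr.
case/is_c4P: C => -[ab bc cd da] ac bd nac nbd.
move: vS; rewrite inE.
have [->|aw'] := eqVneq a w; first by rewrite !inE eqxx.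
have [->|bw'] := eqVneq b w; first by rewrite !inE eqxx orbT.
have [->|cw'] := eqVneq c w; first by rewrite !inE eqxx !orbT.
have [->|dw'] := eqVneq d w; first by rewrite !inE eqxx !orbT.
rewrite !inE => /orP[/or4P[] /eqP vE|v3].
- by rewrite vE aw in vw.
- by rewrite vE bw in vw.
- by rewrite vE cw in vw.
- by rewrite vE dw in vw.
exfalso; have [/andP[va vc]|/andP[vb vd]] :
    edge v a && edge v c \/ edge v b && edge v d.
- by move: v3; rewrite /meets3; case: (edge v a); case: (edge v b);
    case: (edge v c); case: (edge v d); auto.
- by apply: (@claw_free G v a c w).
- by apply: (@claw_free G v b d w).
Qed.

(** Every other vertex of the neighbourhood that misses [a] sees [b], so an independent triple with
    [a] would be a claw at [b]. *)
Lemma square_corner_alpha2 a b c d y z :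
  is_c4 a b c d -> y \in square_nbhd a b c d -> z \in square_nbhd a b c d ->
  a != y -> a != z -> y != z -> [|| edge a y, edge a z | edge y z].
Proof.
move=> /is_c4P[[ab bc cd da] ac bd nac nbd] yS zS ay az yz.
have [//|/negbTE nay] := boolP (edge a y).
have [//|/negbTE naz] := boolP (edge a z).
have [//|/negbTE nyz] := boolP (edge y z); exfalso.
have adj_b u : a != u -> edge a u = false -> u \in square_nbhd a b c d -> edge b u.
  move=> au nau; rewrite !inE eq_sym (negPf au) /=.
  have [uE|_] := eqVneq u b; first by rewrite uE ab in nau.
  have [->//|_] := eqVneq u c.
  have [uE|_] := eqVneq u d; first by rewrite uE edge_sym da in nau.
  by rewrite /meets3 (edge_sym u a) nau !andbF /= orbF => /and3P[]; rewrite edge_sym.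
by apply: (@claw_free G b a y z); rewrite ?[edge b a]edge_sym // adj_b.
Qed.

(** Three vertices off the C_4 miss at most one corner each, so some corner sees all three and would
    be the centre of a claw. *)
Lemma square_nbhd_alpha2 a b c d x y z :
  is_c4 a b c d -> x \in square_nbhd a b c d -> y \in square_nbhd a b c d ->
  z \in square_nbhd a b c d -> x != y -> x != z -> y != z ->
  [|| edge x y, edge x z | edge y z].
Proof.
move=> C xS yS zS xy xz yz.
have corner v u w : v \in [:: a; b; c; d] -> u \in square_nbhd a b c d ->
    w \in square_nbhd a b c d -> v != u -> v != w -> u != w ->
    [|| edge v u, edge v w | edge u w].
  have Cb := is_c4_rot C; have Cc := is_c4_rot Cb; have Cd := is_c4_rot Cc.
  have Sb := square_nbhd_rot a b c d; have Sc := square_nbhd_rot b c d a.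
  have Sd := square_nbhd_rot c d a b.
  rewrite 4!in_cons in_nil orbF => /or4P[] /eqP->.
  - exact: square_corner_alpha2.
  - by rewrite Sb; apply: square_corner_alpha2.
  - by rewrite Sb Sc; apply: square_corner_alpha2.
  - by rewrite Sb Sc Sd; apply: square_corner_alpha2.
have [xC|xC] := boolP (x \in [:: a; b; c; d]); first exact: corner.
have [yC|yC] := boolP (y \in [:: a; b; c; d]).
  have := corner y x z yC xS zS; rewrite (eq_sym y) (edge_sym y x).
  by move=> /(_ xy yz xz)/or3P[]->; rewrite ?orbT.
have [zC|zC] := boolP (z \in [:: a; b; c; d]).
  have := corner z x y zC xS yS; rewrite !(eq_sym z) (edge_sym z x) (edge_sym z y).
  by move=> /(_ xz yz xy)/or3P[]->; rewrite ?orbT.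
have [//|/negbTE nxy] := boolP (edge x y).
have [//|/negbTE nxz] := boolP (edge x z).
have [//|/negbTE nyz] := boolP (edge y z); exfalso.
have claw u : edge x u -> edge y u -> edge z u -> False.
  rewrite edge_sym => ux; rewrite edge_sym => uy; rewrite edge_sym => uz.
  exact: (@claw_free G u x y z).
move: xS yS zS; rewrite !in_set (negPf xC) (negPf yC) (negPf zC) /= /meets3.
move: (claw a) (claw b) (claw c) (claw d).
case: (edge x a); case: (edge x b); case: (edge x c); case: (edge x d) => //=;
case: (edge y a); case: (edge y b); case: (edge y c); case: (edge y d) => //=;
case: (edge z a); case: (edge z b); case: (edge z c); case: (edge z d) => //=;
auto.
Qed.
End SquareNeighbourhood.

(** * Blow-ups of C_6 *)

(* Listing the colours of [L1 :\: L2] first and those of [L2 :\: L1] last, [D]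
   is served from the front of the list and [E] from its back. *)
Lemma two_lists (V T : finType) (f0 : V -> T) (D E : {set V}) (L1 L2 : {set T}) :
  [disjoint D & E] -> #|D| <= #|L1| -> #|E| <= #|L2| ->
  #|D| + #|E| <= #|L1 :|: L2| ->
  exists g : V -> T, [/\ {in D :|: E &, injective g},
    {in D, forall u, g u \in L1} & {in E, forall u, g u \in L2}].
Proof.
move=> DE D1 E2 DE12.
pose s1 := enum (L1 :\: L2); pose s2 := enum (L1 :&: L2).
pose s3 := enum (L2 :\: L1); pose s := s1 ++ s2 ++ s3.
have sz12 : size s1 + size s2 = #|L1|.
  by rewrite -!cardE addnC cardsID.
have sz23 : size s2 + size s3 = #|L2|.
  by rewrite -!cardE setIC cardsID.
have sz : size s = #|L1 :|: L2|.
  rewrite !size_cat addnA sz12 -(cardsID L1 (L1 :|: L2)).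
  by rewrite setUK setDUl setDv set0U -cardE.
have s_uniq : uniq s.
  rewrite !cat_uniq !enum_uniq /= andbT; apply/andP; split; apply/hasPn=> x.
    by rewrite mem_cat !mem_enum !inE; case: (x \in L1) (x \in L2) => [] [].
  by rewrite !mem_enum !inE; case: (x \in L1) (x \in L2) => [] [].
(* Indices start at 0, so the first element of [E] takes position [size s - 1]. The two ranges do
   not overlap since [#|D| + #|E| <= size s]. *)
pose pos u := if u \in D then index u (enum D)
              else size s - (index u (enum E)).+1.
have posD u : u \in D -> pos u < #|D|.
  by move=> uD; rewrite /pos uD cardE index_mem mem_enum.
have idxE u : u \in E -> index u (enum E) < #|E|.
  by move=> uE; rewrite cardE index_mem mem_enum.
have posE u : u \in E -> pos u = size s - (index u (enum E)).+1.
  by move=> uE; rewrite /pos (disjointFl DE uE).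
have lt_pos u : u \in D :|: E -> pos u < size s.
  rewrite inE sz => /orP[/posD lt|uE].
    by apply: leq_trans lt (leq_trans (leq_addr _ _) DE12).
  have := idxE u uE; rewrite posE // sz; move: DE12 (index _ _) => {}DE12 i.
  by clear -DE12; lia.
(* [f0] supplies the default of [nth]; all positions on [D :|: E] are in range, so any common
   default may replace it. *)
pose g u := nth (f0 u) s (pos u).
have gE x0 u : u \in D :|: E -> g u = nth x0 s (pos u).
  by move=> uDE; apply/set_nth_default/lt_pos.
have inD u : u \in D -> u \in D :|: E by rewrite inE => ->.
have inE' u : u \in E -> u \in D :|: E by rewrite inE => ->; rewrite orbT.
exists g; split.
- move=> u v uDE vDE; rewrite (gE (f0 v) u) // => /eqP.
  rewrite nth_uniq ?lt_pos // => /eqP.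
  have sep x y : x \in D -> y \in E -> pos x <> pos y.
    move=> /posD xD yE; have := idxE y yE; rewrite (posE y) // sz.
    move: (index _ _) (pos x) xD => i j xD iE.
    by clear -DE12 xD iE; lia.
  case/setUP: (uDE) => [uD|uE]; case/setUP: (vDE) => [vD|vE].
  + rewrite /pos uD vD => euv.
    by apply: (@index_inj _ u (enum D)); rewrite ?mem_enum.
  + by move/(sep _ _ uD vE).
  + by move/esym/(sep _ _ vD uE).
  + have iu := idxE u uE; have iv := idxE v vE.
    rewrite !posE // sz => euv.
    apply: (@index_inj _ u (enum E)); rewrite ?mem_enum //.
    move: (index u _) (index v _) euv iu iv => i j euv iu iv.
    by clear -euv iu iv DE12; lia.
- move=> u uD; have lt : pos u < size (s1 ++ s2).
    by rewrite size_cat sz12; apply: leq_trans (posD u uD) D1.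
  have : g u \in s1 ++ s2 by rewrite /g /s catA nth_cat lt mem_nth.
  by rewrite mem_cat !mem_enum !inE; case: (g u \in L1); rewrite ?andbF.
- move=> u uE; have : g u \in s2 ++ s3.
    have iu := idxE u uE; have le1 : size s1 <= pos u.
      move: sz; rewrite posE // !size_cat; move: iu.
      move: (index _ _) (size s1) (size s2) (size s3) sz23 => i n1 n2 n3 sz23 iu sz.
      by clear -sz23 E2 iu; lia.
    rewrite /g /s nth_cat ltnNge le1 /= mem_nth //.
    rewrite -(ltn_add2l (size s1)) subnKC // -size_cat.
    exact/lt_pos/inE'.
  by rewrite mem_cat !mem_enum !inE; case: (g u \in L2); rewrite ?andbF.
Qed.

(** * Painting a blow-up of C_6 *)

Section BlowUp.
Variables (G : sgraph) (k : nat) (f : G -> 'I_k).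
Hypothesis fP : proper_coloring f.
Implicit Types (c : position G k) (u v w : G) (S : {set G}).

Definition used c S := [set a | [exists u in S, c u == Some a]].

Lemma usedP c S a : reflect (exists2 u, u \in S & c u = Some a) (a \in used c S).
Proof.
rewrite inE; apply: (iffP existsP) => [[u /andP[uS /eqP cu]]|[u uS cu]].
  by exists u.
by exists u; rewrite uS cu eqxx.
Qed.

Lemma used_imset c S : {in S, forall u, c u != None} ->
  used c S = [set odflt (f u) (c u) | u in S].
Proof.
move=> cS; apply/setP=> a; apply/usedP/imsetP=> -[u uS].
  by move=> cu; exists u; rewrite ?cu.
by have := cS u uS; case cu: (c u) => [b|//] _ ->; exists u.
Qed.

Lemma card_used c S : {in S, forall u, c u != None} -> #|used c S| <= #|S|.
Proof. by move=> /used_imset->; apply: leq_imset_card. Qed.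

Lemma card_used_clique c S : properly_colored c -> clique S ->
  {in S, forall u, c u != None} -> #|used c S| = #|S|.
Proof.
move=> pc Scl cS; rewrite used_imset // card_in_imset // => u v uS vS.
case cu: (c u) (cS u uS) => [a|//] _; case cv: (c v) (cS v vS) => [b|//] _ /= ab.
have [//|/(Scl _ _ uS vS) uv] := eqVneq u v.
by have := pc u v a uv cu; rewrite cv ab eqxx.
Qed.

(* [t] maps a blow-up of [C_6] by cliques onto [C_6]. *)
Variables (K : {set G}) (t : G -> nat).

Definition close i j := [|| i == j, i.+1 %% 6 == j | j.+1 %% 6 == i].

Lemma close_sym i j : close i j = close j i.
Proof. by rewrite /close eq_sym; congr (_ || _); rewrite orbC. Qed.

Hypothesis t_lt6 : {in K, forall u, t u < 6}.
Hypothesis edgeE : {in K &, forall u v, edge u v = (u != v) && close (t u) (t v)}.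

Definition part i := [set u in K | t u == i].

Lemma part_clique i j : close i j -> clique (part i :|: part j).
Proof.
move=> cij u v uP vP uv; have uK : u \in K.
  by move: uP; rewrite !inE => /orP[] /andP[].
have vK : v \in K by move: vP; rewrite !inE => /orP[] /andP[].
rewrite edgeE // uv; move: uP vP; rewrite !inE uK vK /=.
move=> /orP[] /eqP-> /orP[] /eqP-> //; rewrite 1?close_sym //.
all: by rewrite /close eqxx.
Qed.

Lemma part_disjoint i j : i != j -> [disjoint part i & part j].
Proof.
move=> ij; rewrite -setI_eq0; apply/eqP/setP=> u; rewrite !inE.
by case: (u \in K) => //=; case: (eqVneq (t u) i) => //= ->; apply: negbTE.
Qed.

Lemma part_pair_card i j :
  i != j -> close i j -> #|part i| + #|part j| <= k.
Proof.
move=> ij /part_clique cl; have := clique_card fP cl.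
by rewrite cardsU (disjoint_setI0 (part_disjoint ij)) cards0 subn0.
Qed.

Lemma partP i u : reflect (u \in K /\ t u = i) (u \in part i).
Proof. by rewrite inE; apply: (iffP andP) => -[uK /eqP]. Qed.

(* A colour lost to both of these parts is used on
   [part 2] and [part 5], hence not on [part 0] and [part 1]; the size
   assumption leaves enough of the other colours. *)
Lemma paint_blowup c :
  #|part 3| + #|part 4| <= #|part 0| + #|part 1| ->
  properly_colored c -> {in K, forall u, c u = None} ->
  (forall u w, u \in K -> edge u w -> w \in K) ->
  forces (extends K c) c.
Proof.
move=> le34 pc cK cN.
have KE : K = (part 0 :|: part 1) :|: (part 2 :|: part 5) :|: (part 3 :|: part 4).
  apply/setP=> u; rewrite !inE; case uK: (u \in K) => //=.
  by have := t_lt6 uK; case: (t u) => [|[|[|[|[|[|]]]]]].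
have PK i j u : u \in part i :|: part j -> u \in K.
  by case/setUP=> /partP[].
have nbr u w : u \in K -> edge u w -> w \in K /\ close (t u) (t w).
  move=> uK uw; have wK := cN u w uK uw; split=> //.
  by move: uw; rewrite edgeE // => /andP[].
(* Parts 0 and 1 come first, then parts 2 and 5, all greedily; the clique formed by parts 3 and 4 is
   kept for the laminar phase. *)
rewrite {1}KE; apply: paint_bind; first apply: paint_bind.
- apply: (@paint_greedy _ _ (fun=> part 0 :|: part 1)) => //.
  + by move=> u /PK/cK.
  + by move=> _ _; apply: (clique_card fP (part_clique _)).
  + by move=> u w /PK uK uw; rewrite cK ?orbF //; apply: cN uw.
- move=> c1 [pc1 _ c1E].
  have c1N u : u \in K -> c1 u != None -> u \in part 0 :|: part 1.
    by move=> uK; apply: contraR => /c1E->; rewrite cK.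
  (* Parts 3 and 4 are still blank, so a vertex of part 2 competes only with parts 1 and 2, and one
     of part 5 only with parts 5 and 0. *)
  apply: (@paint_greedy _ _
    (fun u => if t u == 2 then part 1 :|: part 2 else part 5 :|: part 0)) => //.
  + move=> u uP; have uK := PK _ _ _ uP; rewrite c1E ?cK //.
    by case/setUP: uP => /partP[_ tu]; rewrite !inE uK tu.
  + by move=> u /setUP[]/partP[uK tu]; rewrite tu !inE uK tu.
  + by move=> u /setUP[]/partP[_ ->]; apply: (clique_card fP (part_clique _)).
  + move=> u w uP uw cand; have [wK] := nbr u w (PK _ _ _ uP) uw.
    have {cand} : (w \in part 2 :|: part 5) || (w \in part 0 :|: part 1).
      by case/orP: cand => [->//|/(c1N _ wK)->]; rewrite orbT.
    case/setUP: uP => /partP[_ ->]; rewrite /= !inE wK /=;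
    by case: (t w) => [|[|[|[|[|[|]]]]]].
move=> c2 [pc2 c2S c2E].
have c2P i : i \in [:: 0; 1; 2; 5] -> {in part i, forall u, c2 u != None}.
  move=> iP u ui; apply: c2S; rewrite !in_setU; move: iP ui; rewrite !in_cons.
  by case/or4P=> [/eqP->|/eqP->|/eqP->|/orP[/eqP->|//]] ->; rewrite ?orbT.
have c2N i u : i \in [:: 3; 4] -> u \in part i -> c2 u = None.
  move=> iP /partP[uK tu]; rewrite c2E ?cK // !inE uK tu.
  by case/or3P: iP => // /eqP->.
have c2P2 := c2P 2 isT; have c2P5 := c2P 5 isT.
(* Coloured neighbours of part 3 lie in part 2 and those of part 4 in part 5, so all vertices of one
   part have the same list. *)
have leg i j u a : (i, j) \in [:: (3, 2); (4, 5)] -> u \in part i ->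
    legal c2 u a = (a \notin used c2 (part j)).
  move=> ij /partP[uK tu]; apply/forallP/negP => [lu /usedP[w /partP[wK tw] cw]|nu w].
    have := lu w; rewrite cw eqxx implybF edgeE // tu tw.
    have [uw|_ /=] := eqVneq u w; first by rewrite uw tw in tu;
      move: ij; rewrite -tu; case: (j) => [|[|[|[|[|[|]]]]]].
    by case/or3P: ij => // /eqP[-> ->].
  apply/implyP=> /(nbr u w uK)[wK cl]; apply/eqP=> cw; apply: nu.
  apply/usedP; exists w => //; apply/partP; split=> //.
  have w3 : w \notin part 3 by apply/negP=> /(c2N 3 w isT); rewrite cw.
  have w4 : w \notin part 4 by apply/negP=> /(c2N 4 w isT); rewrite cw.
  have := t_lt6 wK; move: w3 w4 cl; rewrite !inE wK tu /=.
  by case/or3P: ij => // /eqP[-> ->]; case: (t w) => [|[|[|[|[|[|]]]]]].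
have [|||g [g_inj g3 g4]] := @two_lists _ _ f (part 3) (part 4)
    (~: used c2 (part 2)) (~: used c2 (part 5)) (@part_disjoint 3 4 isT).
- rewrite -(leq_add2l #|used c2 (part 2)|) cardsC card_ord.
  apply: leq_trans (@part_pair_card 2 3 isT isT).
  by rewrite leq_add2r card_used.
- rewrite -(leq_add2l #|used c2 (part 5)|) cardsC card_ord addnC.
  apply: leq_trans (@part_pair_card 4 5 isT isT).
  by rewrite leq_add2l card_used.
- apply: leq_trans le34 _.
  have cl01 : clique (part 0 :|: part 1) by apply: part_clique.
  have col01 : {in part 0 :|: part 1, forall u, c2 u != None}.
    by move=> u /setUP[]; apply: c2P.
  have <- : #|used c2 (part 0 :|: part 1)| = #|part 0| + #|part 1|.
    rewrite card_used_clique // cardsU.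
    by rewrite (disjoint_setI0 (@part_disjoint 0 1 isT)) cards0 subn0.
  apply/subset_leq_card/subsetP=> a /usedP[u u01 cu].
  rewrite in_setU !in_setC -negb_and.
  apply/negP=> /andP[/usedP[w /partP[wK tw] cw] /usedP[x /partP[xK tx] cx]].
  have uK := PK _ _ _ u01.
  have clash y : c2 y = Some a -> edge u y = false.
    by move=> cy; apply/negP=> uy; have := pc2 u y a uy cu; rewrite cy eqxx.
  case/setUP: u01 => /partP[_ tu].
    have := clash x cx; rewrite edgeE // tu tx andbT.
    by move/negbFE/eqP=> ux; rewrite ux tx in tu.
  have := clash w cw; rewrite edgeE // tu tw andbT.
  by move/negbFE/eqP=> uw; rewrite uw tw in tu.
have legD u a : u \in part 3 -> legal c2 u a = (a \notin used c2 (part 2)).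
  exact: leg.
have legE u a : u \in part 4 -> legal c2 u a = (a \notin used c2 (part 5)).
  exact: leg.
apply: (@paint_laminar _ _ _ _ g) => //.
- by move=> u /setUP[]; apply: c2N.
- exact: part_clique.
- by move=> u /setUP[uP|uP]; [rewrite legD|rewrite legE] => //;
    [have := g3 u uP|have := g4 u uP]; rewrite inE.
(* Within a part the lists coincide; a colour shared across the two parts is in every list. *)
move=> u v a /setUP[uP|uP] /setUP[vP|vP].
- by move=> _ _; apply: Or32 => b; rewrite !legD.
- rewrite legD // legE // => a2 a5; apply: Or31 => w.
  by case/setUP=> wP; [rewrite legD|rewrite legE].
- rewrite legE // legD // => a5 a2; apply: Or31 => w.
  by case/setUP=> wP; [rewrite legD|rewrite legE].
- by move=> _ _; apply: Or32 => b; rewrite !legE.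
Qed.
End BlowUp.

(** A half-turn of C_6 exchanges the two opposite pairs of parts, so the pair kept for the end may
    be taken to be the smaller one. *)
Lemma paint_c6_blowup (G : sgraph) k (f : G -> 'I_k) (K : {set G}) (t : G -> nat)
    (c : position G k) :
  proper_coloring f -> {in K, forall u, t u < 6} ->
  {in K &, forall u v, edge u v = (u != v) && close (t u) (t v)} ->
  properly_colored c -> {in K, forall u, c u = None} ->
  (forall u w, u \in K -> edge u w -> w \in K) ->
  forces (extends K c) c.
Proof.
move=> fP t6 eE pc cK cN.
have [le34|/ltnW le01] := leqP (#|part K t 3| + #|part K t 4|)
                               (#|part K t 0| + #|part K t 1|).
  exact: (paint_blowup fP t6 eE).
pose t' u := (t u + 3) %% 6.
have t'P i j : (i, j) \in [:: (0, 3); (1, 4); (3, 0); (4, 1)] ->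
    part K t' j = part K t i.
  move=> ij; apply/setP=> u; rewrite !inE; case uK: (u \in K) => //=.
  have := t6 u uK; rewrite /t'; case/or4P: ij => [| | |/orP[|//]] /eqP[-> ->];
  by case: (t u) => [|[|[|[|[|[|]]]]]].
apply: (@paint_blowup _ _ _ fP _ t') => //.
- by move=> u _; apply: ltn_mod.
- move=> u v uK vK; rewrite eE //; congr andb.
  have := t6 u uK; have := t6 v vK; rewrite /t'.
  by case: (t u) => [|[|[|[|[|[|]]]]]]; case: (t v) => [|[|[|[|[|[|]]]]]].
- by rewrite (t'P 0 3) // (t'P 1 4) // (t'P 3 0) // (t'P 4 1).
Qed.

(** * The component of an induced C_6 as a blow-up *)

Section Hexagon.
Variables (G : sgraph) (K : {set G}).
Hypothesis P6_free : ~~ contains_induced (path_graph 6) G.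
Hypothesis C5_free : ~~ contains_induced (cycle_graph 5) G.
Hypothesis claw_free_G : ~~ contains_induced (biclique 1 3) G.
Hypothesis K_closed : forall u w, u \in K -> edge u w -> w \in K.
Hypothesis K_C4_free : c4_free_in K.
Implicit Types a b c d e f u v w x y z p q : G.

Lemma no_c4 a b c d : a \in K ->
  edge a b -> edge b c -> edge c d -> edge d a -> a != c -> b != d ->
  edge a c = false -> edge b d = false -> False.
Proof.
move=> aK ab bc cd da ac bd nac nbd.
have bK := K_closed aK ab; have cK := K_closed bK bc.
have := K_C4_free aK bK cK (K_closed cK cd).
by have/is_c4P-> : [/\ [/\ edge a b, edge b c, edge c d & edge d a],
  a != c, b != d, edge a c = false & edge b d = false].
Qed.

Definition hexagon a b c d e f := is_c6 a b c d e f && (a \in K).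

Lemma hexagonP a b c d e f : reflect
  [/\ a \in K,
      [/\ edge a b, edge b c & edge c d], [/\ edge d e, edge e f & edge f a],
      [/\ edge a c = false, edge b d = false & edge c e = false] &
      [/\ [/\ edge d f = false, edge e a = false & edge f b = false],
          edge a d = false, edge b e = false & edge c f = false]]
  (hexagon a b c d e f).
Proof.
rewrite /hexagon /is_c6; apply: (iffP idP).
  case/andP=> + aK; do 6!case/andP=> ?; do 8!case/andP=> /negbTE ?.
  by move/negbTE.
by case=> -> [-> -> ->] [-> -> ->] [-> -> ->] [[-> -> ->] -> -> ->].
Qed.

Lemma hexagon_rot a b c d e f : hexagon a b c d e f -> hexagon b c d e f a.
Proof.
case/hexagonP=> aK [ab bc cd] [de ef fa] [ac bd ce] [[df ea fb] ad be cf].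
apply/hexagonP; split; [exact: K_closed aK ab|by []|by []|by []|].
by split=> //; rewrite edge_sym.
Qed.

(** Five vertices of the hexagon are prescribed. The sixth, between [p] and [q], is left open, so
    that it belongs to its own slot. *)
Definition slot p q x y z :=
  [set v in K | [&& edge v p, edge v q, ~~ edge v x, ~~ edge v y & ~~ edge v z]].

Lemma slotP p q x y z v : reflect
  [/\ v \in K, edge v p, edge v q &
      [/\ edge v x = false, edge v y = false & edge v z = false]]
  (v \in slot p q x y z).
Proof.
rewrite inE; apply: (iffP idP); last by case=> -> -> -> [-> -> ->].
by case/and5P=> ? ? ? /negbTE ? /andP[/negbTE ? /negbTE].
Qed.

Lemma neq_nbr x y z : edge x z -> edge y z = false -> x != y.
Proof. by move=> xz; apply: contraFneq => <-. Qed.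

Section Slots.
Variables (a b c d e f : G).
Hypothesis H : hexagon a b c d e f.

(** This and the next three lemmas compare the slot of [b] with those at distance 0, 1, 2 and 3; a
    violation closes up through the hexagon to a C_4, P_6, C_5 or C_4. Rotations give all other
    pairs. *)
Lemma slot_clique u v :
  u \in slot a c d e f -> v \in slot a c d e f -> u != v -> edge u v.
Proof.
case/hexagonP: H => aK [ab bc cd] [de ef fa] [ac bd ce] [[df ea fb] ad be cf].
case/slotP=> uK ua uc [ud ue uf] /slotP[vK va vc [vd ve vf]] uv.
case nuv: (edge u v) => //; exfalso.
by apply: (@no_c4 u a v c); try edges; apply: (@neq_nbr _ _ f); edges.
Qed.

Lemma slot_join u v :
  u \in slot a c d e f -> v \in slot b d e f a -> edge u v.
Proof.
case/hexagonP: H => aK [ab bc cd] [de ef fa] [ac bd ce] [[df ea fb] ad be cf].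
case/slotP=> uK ua uc [ud ue uf] /slotP[vK vb vd [ve vf va]].
case nuv: (edge u v) => //; exfalso.
by apply: (@path6_free G u a f e d v); edges.
Qed.

Lemma slot_anti2 u v :
  u \in slot a c d e f -> v \in slot c e f a b -> edge u v = false.
Proof.
case/hexagonP: H => aK [ab bc cd] [de ef fa] [ac bd ce] [[df ea fb] ad be cf].
case/slotP=> uK ua uc [ud ue uf] /slotP[vK vc ve [vf va vb]].
apply/negP=> uv; by apply: (@cycle5_free G u a f e v); edges.
Qed.

Lemma slot_anti3 u v :
  u \in slot a c d e f -> v \in slot d f a b c -> edge u v = false.
Proof.
case/hexagonP: H => aK [ab bc cd] [de ef fa] [ac bd ce] [[df ea fb] ad be cf].
case/slotP=> uK ua uc [ud ue uf] /slotP[vK vd vf [va vb vc]].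
apply/negP=> uv; apply: (@no_c4 u a f v); try edges.
  by apply: (@neq_nbr _ _ c); edges.
by apply: (@neq_nbr _ _ b); edges.
Qed.

(** Such a [v] would be the third leaf, beside [a] and [c], of a claw at [u]. *)
Lemma slot_far u v : u \in slot a c d e f -> edge u v ->
  edge v a = false -> edge v b = false -> edge v c = false -> False.
Proof.
case/hexagonP: H => aK [ab bc cd] [de ef fa] [ac bd ce] [[df ea fb] ad be cf].
case/slotP=> uK ua uc [ud ue uf] uv va vb vc.
have av : a != v by apply: (neq_nbr ab).
have cv : c != v by apply: (@neq_nbr _ _ b); edges.
apply: (@claw_free G u a c v); try edges.
by apply: (@neq_nbr _ _ f); edges.
Qed.

Definition slots :=
  [:: slot f b c d e; slot a c d e f; slot b d e f a;
      slot c e f a b; slot d f a b c; slot e a b c d].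

(** The vertices [b] and [f] lie in their own slots. For any other [v], each of the 32 adjacency
    patterns to the five other vertices matches a slot or yields a C_4, C_5, claw or P_6. *)
Lemma nbr_in_slots v : edge a v -> has (fun S : {set G} => v \in S) slots.
Proof.
case/hexagonP: H => aK [ab bc cd] [de ef fa] [ac bd ce] [[df ea fb] ad be cf].
move=> av; have vK := K_closed aK av.
have va : edge v a by rewrite edge_sym.
have [->|vb] := eqVneq v b.
  rewrite /slots /= !inE (K_closed aK ab) (edge_sym b a) (edge_sym b f).
  by rewrite ab bc bd be fb !orbT.
have [->|vf] := eqVneq v f.
  have fK : f \in K by apply: (K_closed aK); edges.
  rewrite /slots /= !inE fK (edge_sym f e) (edge_sym f c) (edge_sym f d).
  by rewrite ef fa fb cf df !orbT.
have vc : v != c by apply: (neq_nbr va); edges.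
have vd : v != d by apply: (neq_nbr va); edges.
have ve : v != e by apply: (neq_nbr va); edges.
have ac' : a != c by apply: (@neq_nbr _ _ f); edges.
have bd' : b != d by apply: (@neq_nbr _ _ a); edges.
have ce' : c != e by apply: (@neq_nbr _ _ b); edges.
have df' : d != f by apply: (@neq_nbr _ _ c); edges.
have ea' : e != a by apply: (@neq_nbr _ _ d); edges.
have fb' : f != b by apply: (@neq_nbr _ _ e); edges.
have c4 p q r : v \in K -> edge v p -> edge p q -> edge q r -> edge r v ->
  v != q -> p != r -> edge v q = false -> edge p r = false -> False := @no_c4 v p q r.
have claw x p q r := @claw_free G x p q r claw_free_G.
have c5 p q r s := @cycle5_free G v p q r s C5_free.
have p6 p q r s u := @path6_free G v p q r s u P6_free.
rewrite /slots /= !inE vK va /=.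
case vb' : (edge v b); case vc' : (edge v c); case vd' : (edge v d);
case ve' : (edge v e); case vf' : (edge v f); rewrite ?orbT //; exfalso.
all: first [ by apply: (c4 a b c); edges | by apply: (c4 b c d); edges
           | by apply: (c4 c d e); edges | by apply: (c4 d e f); edges
           | by apply: (c4 e f a); edges | by apply: (c4 f a b); edges
           | by apply: (c5 a b c d); edges | by apply: (c5 b c d e); edges
           | by apply: (c5 c d e f); edges | by apply: (c5 d e f a); edges
           | by apply: (c5 e f a b); edges | by apply: (c5 f a b c); edges
           | by apply: (claw v a c e); edges | by apply: (claw v b d f); edges
           | by apply: (claw a f b v); edges
           | by apply: (p6 b c d e f); edges | by apply: (p6 f e d c b); edges ].
Qed.
End Slots.

Lemma slots_rot a b c d e f : slots b c d e f a = rot 1 (slots a b c d e f).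
Proof. by []. Qed.

Lemma nbrs_in_slots a b c d e f v :
  hexagon a b c d e f -> has (edge v) [:: a; b; c; d; e; f] ->
  has (fun S : {set G} => v \in S) (slots a b c d e f).
Proof.
move=> H; rewrite /= orbF !(edge_sym v).
have Hb := hexagon_rot H; have Hc := hexagon_rot Hb; have Hd := hexagon_rot Hc.
have He := hexagon_rot Hd; have Hf := hexagon_rot He.
case/orP=> [/(nbr_in_slots H)//|].
case/orP=> [/(nbr_in_slots Hb)|]; first by rewrite slots_rot has_rot.
case/orP=> [/(nbr_in_slots Hc)|]; first by rewrite 2!slots_rot 2!has_rot.
case/orP=> [/(nbr_in_slots Hd)|]; first by rewrite 3!slots_rot 3!has_rot.
case/orP=> [/(nbr_in_slots He)|]; first by rewrite 4!slots_rot 4!has_rot.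
by move=> /(nbr_in_slots Hf); rewrite 5!slots_rot 5!has_rot.
Qed.

(** By [slot_far], a neighbour of a slot sees the hexagon, hence lies in a slot itself. So the slots
    cover the whole component. *)
Lemma slots_closed a b c d e f u v :
  hexagon a b c d e f -> has (fun S : {set G} => u \in S) (slots a b c d e f) ->
  edge u v -> has (fun S : {set G} => v \in S) (slots a b c d e f).
Proof.
move=> H uS uv; apply: (nbrs_in_slots H).
have Hb := hexagon_rot H; have Hc := hexagon_rot Hb; have Hd := hexagon_rot Hc.
have He := hexagon_rot Hd; have Hf := hexagon_rot He.
apply: contraT => /=; rewrite !negb_or.
move=> /and5P[/negbTE va /negbTE vb /negbTE vc /negbTE vd].
move=> /and3P[/negbTE ve /negbTE vf _]; exfalso.
move: uS => /=; rewrite orbF.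
case/orP=> [uS|]; first exact: (slot_far Hf uS uv).
case/orP=> [uS|]; first exact: (slot_far H uS uv).
case/orP=> [uS|]; first exact: (slot_far Hb uS uv).
case/orP=> [uS|]; first exact: (slot_far Hc uS uv).
case/orP=> [uS|uS]; first exact: (slot_far Hd uS uv).
exact: (slot_far He uS uv).
Qed.

(** The map of the blow-up onto C_6. *)
Definition slot_index a b c d e f v :=
  find (fun S : {set G} => v \in S) (slots a b c d e f).

Lemma slot_edge a b c d e f u v :
  hexagon a b c d e f ->
  has (fun S : {set G} => u \in S) (slots a b c d e f) ->
  has (fun S : {set G} => v \in S) (slots a b c d e f) ->
  edge u v = (u != v)
    && close (slot_index a b c d e f u) (slot_index a b c d e f v).
Proof.
move=> H uS vS; have [->|uv] := eqVneq u v; first by rewrite edge_irr.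
have Hb := hexagon_rot H; have Hc := hexagon_rot Hb; have Hd := hexagon_rot Hc.
have He := hexagon_rot Hd; have Hf := hexagon_rot He.
have := nth_find set0 uS; have := nth_find set0 vS.
move: (uS) (vS); rewrite !has_find -!/(slot_index a b c d e f _).
case: (slot_index _ _ _ _ _ _ u) => [|[|[|[|[|[|//]]]]]] _;
case: (slot_index _ _ _ _ _ _ v) => [|[|[|[|[|[|//]]]]]] _ /= {uS}vS {}uS;
rewrite /close /=.
(* Each of the 36 pairs of slots is a rotation of one of the four compared pairs, up to order. *)
all: let lem H := first [ exact: (slot_clique H uS vS uv)
  | exact: (slot_join H uS vS) | rewrite edge_sym; exact: (slot_join H vS uS)
  | exact: (slot_anti2 H uS vS) | rewrite edge_sym; exact: (slot_anti2 H vS uS)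
  | exact: (slot_anti3 H uS vS) ] in
  first [lem H | lem Hb | lem Hc | lem Hd | lem He | lem Hf].
Qed.
End Hexagon.

(** * Components *)

(** The last hypothesis expresses connectedness of [K]: an edge-closed set that meets [K] contains
    it. It is applied to the neighbourhood of a C_4 and to the union of the slots. *)
Lemma paint_component (G : sgraph) k (f : G -> 'I_k) (K : {set G})
    (c : position G k) :
  ~~ contains_induced (path_graph 6) G ->
  ~~ contains_induced (cycle_graph 5) G ->
  ~~ contains_induced (compl_graph (path_graph 5)) G ->
  ~~ contains_induced (biclique 1 3) G ->
  proper_coloring f -> properly_colored c -> {in K, forall u, c u = None} ->
  (forall u w, u \in K -> edge u w -> w \in K) ->
  (forall (S : {set G}) u, (forall v w, v \in S -> edge v w -> w \in S) ->
     u \in K -> u \in S -> K \subset S) ->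
  forces (extends K c) c.
Proof.
move=> P6f C5f coP5f clawf fP pc cK K_closed K_conn.
have [/existsP[a /andP[aK /existsP[b /existsP[d /existsP[e C4]]]]]|noC4] :=
    boolP [exists a in K, exists b, exists d, exists e, is_c4 a b d e].
  have /subsetP KS : K \subset square_nbhd a b d e.
    apply: (K_conn _ a) => //; last by rewrite !inE eqxx.
    by move=> v w; apply: square_nbhd_closed.
  have [|A [B [KE AB Acl Bcl]]] := @two_cliques G C5f coP5f K.
    by move=> x y z /KS xS /KS yS /KS zS; apply: (square_nbhd_alpha2 clawf C4).
  by rewrite -KE in cK K_closed *; apply: (paint_two_cliques fP).
have K4 : c4_free_in K.
  move=> a b d e aK bK dK eK; apply: contraNF noC4 => C4.
  apply/existsP; exists a; rewrite aK; apply/existsP; exists b.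
  by apply/existsP; exists d; apply/existsP; exists e.
have [/existsP[a /existsP[b /existsP[d /existsP[e /existsP[x /existsP[y H]]]]]]|noC6] :=
    boolP [exists a, exists b, exists d, exists e, exists x, exists y,
           hexagon K a b d e x y].
  pose in_slots v := has (fun S : {set G} => v \in S) (slots K a b d e x y).
  have KS v : v \in K -> in_slots v.
    have /subsetP KS : K \subset [set v | in_slots v].
      have [aK [ab _ _] _ _ _] := hexagonP _ _ _ _ _ _ _ H.
      apply: (K_conn _ a) => //.
        move=> u w; rewrite !inE; exact: slots_closed H.
      by rewrite inE; apply: nbrs_in_slots H _; rewrite //= ab ?orbT.
    by move/KS; rewrite inE.
  apply: (paint_c6_blowup (t := slot_index K a b d e x y) fP) => //.
    by move=> u /KS; rewrite /in_slots has_find.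
  by move=> u v /KS uS /KS vS; apply: slot_edge.
apply: (paint_chordal fP) => //.
  move=> a b d e x y aK _ _ _ _ _; apply: contraNF noC6 => C6.
  apply/existsP; exists a; apply/existsP; exists b; apply/existsP; exists d.
  apply/existsP; exists e; apply/existsP; exists x; apply/existsP; exists y.
  by rewrite /hexagon C6.
by move=> u w uK uw; apply: cK; apply: K_closed uK uw.
Qed.

Theorem corollary2p12 (G : sgraph)
    (hfree : family_free [:: path_graph 6; cycle_graph 5;
                             compl_graph (path_graph 5); biclique 1 3] G)
    (hC6 : contains_induced (cycle_graph 6) G)
    (k : nat) (hk : chromatic_number G <= k) :
  indicated_colorable G k.
Proof.
have /and5P[P6f C5f coP5f clawf _] := hfree.
have [f fP] := ex_proper_coloring hk; apply: forces_ann_wins.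
(* Generalised to positions in which every component is either fully coloured or blank; the
   induction is on the number of uncoloured vertices. *)
suff main (c : position G k) : properly_colored c ->
    (forall u w, edge u w -> c u != None -> c w != None) ->
    forces (fun c' => all_colored c') c.
  by apply: main => [u v a|u w] _; rewrite ffunE.
have [n] := ubnP #|[set u | c u == None]|; elim: n => // n IH in c *.
move=> cn pc cN.
have [col|] := boolP (all_colored c); first exact: forces_now.
rewrite negb_forall => /existsP[x]; rewrite negbK => cx.
pose K := [set y | connect (@edge G) x y].
have csym : connect_sym (@edge G) by apply: sym_connect_sym; apply: edge_sym.
have uncolored u w : connect (@edge G) u w -> (c u == None) = (c w == None).
  apply: (@closed_connect _ _ [pred u | c u == None]).
  apply: intro_closed => // v z vz /=; rewrite !inE; apply: contraLR.
  by apply: cN; rewrite edge_sym.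
have cK : {in K, forall u, c u = None}.
  by move=> u; rewrite inE => /uncolored; rewrite cx => /esym/eqP.
have K_closed u w : u \in K -> edge u w -> w \in K.
  by rewrite !inE => xu uw; apply: connect_trans xu (connect1 uw).
(* The blank component [K] of [x] is painted completely, which restores the invariant with fewer
   uncoloured vertices. *)
apply: (@forces_bind _ _ (extends K c)).
  apply: (paint_component P6f C5f coP5f clawf fP) => //.
  move=> S u S_closed; rewrite inE => xu uS; apply/subsetP=> v.
  rewrite inE => xv; have uv : connect (@edge G) u v.
    by apply: connect_trans xv; rewrite csym.
  have : closed (@edge G) (mem S).
    by apply: intro_closed => // ? ? /[swap]; apply: S_closed.
  by move/closed_connect/(_ _ _ uv) => <-.
move=> c' [pc' c'K c'E]; apply: IH => //.
  rewrite ltnS in cn; apply: leq_trans cn; apply: proper_card; apply/properP.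
  have xK : x \in K by rewrite inE connect0.
  split; last by exists x; rewrite !inE // (negPf (c'K x xK)).
  apply/subsetP=> u; rewrite !inE; have [/c'K/negPf-> //|/c'E->//] := boolP (u \in K).
move=> u w uw; have [/K_closed/(_ uw)/c'K //|uK] := boolP (u \in K).
rewrite c'E // => /(cN _ _ uw); have [/c'K //|/c'E->//] := boolP (w \in K).
Qed.
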